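(* Consider the cascaded family of discrete-time systems, parameterized by the sampling period $T>0$, $$x(k+1)=f_T(k,x(k),z(k)),\qquad (\mathrm{X})$$ $$z(k+1)=g_T(k,z(k)),\qquad (\mathrm{Z})$$ with $x\in\mathbb{R}^{n_x}$, $z\in\mathbb{R}^{n_z}$, state $\xi=(x^T\ z^T)^T$, and the auxiliary system $$x(k+1)=f_T(k,x(k),0).\qquad (\mathrm{X}_0)$$ Suppose that there exist $\gamma_2\in\mathcal{N}$, $\gamma_1,\gamma_3\in\mathcal{K}_\infty$ and $T^*>0$ such that for all $\xi=(x^T\ z^T)^T\in\mathbb{R}^{n_x+n_z}$, $k\ge0$ and $T\in(0,T^* )$, $$|f_T(k,x,z)|\le\gamma_1(|\xi|),\qquad |f_T(k,x,z)-f_T(k,x,0)|\le T\,\gamma_2(|x|)\,\gamma_3(|z|).$$ (Semiglobal version) If (1) the system (X$_0$) is Lyapunov SP-UAS, (2) the system (Z) is SP-UAS, and (3) the cascade (X),(Z) is USB, then the cascade (X),(Z) is SP-UAS. (Global version) If (1) the system (X$_0$) is Lyapunov UGAS, (2) the system (Z) is UGAS, and (3) the cascade (X),(Z) is UGB, then the cascade (X),(Z) is UGAS.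
   Context: Notation. $|\cdot|$ is the Euclidean norm. Times $k,k_\circ$ are nonnegative integers. For each $T>0$, $f_T:\mathbb{Z}_{\ge0}\times\mathbb{R}^{n_x}\times\mathbb{R}^{n_z}\to\mathbb{R}^{n_x}$ and $g_T:\mathbb{Z}_{\ge0}\times\mathbb{R}^{n_z}\to\mathbb{R}^{n_z}$. A function $\alpha:\mathbb{R}_{\ge0}\to\mathbb{R}_{\ge0}$ is of class $\mathcal{K}$ if it is continuous, strictly increasing and $\alpha(0)=0$; of class $\mathcal{K}_\infty$ if in addition it is unbounded. A function $\gamma:\mathbb{R}_{\ge0}\to\mathbb{R}_{\ge0}$ is of class $\mathcal{N}$ if it is continuous and nondecreasing. A function $\beta:\mathbb{R}_{\ge0}\times\mathbb{R}_{\ge0}\to\mathbb{R}_{\ge0}$ is of class $\mathcal{KL}$ if $\beta(\cdot,t)\in\mathcal{K}$ for every $t\ge0$ and $\beta(s,\cdot)$ is decreasing to zero for every $s>0$. For a family of systems $y(k+1)=F_T(k,y(k))$, $y\in\mathbb{R}^n$, $\phi_T^y(k,k_\circ,y_\circ)$ denotes the solution at time $k\ge k_\circ$ starting from $y_\circ$ at time $k_\circ$. SP-UAS / UGAS. The family $y(k+1)=F_T(k,y(k))$ is semiglobally practically uniformly asymptotically stable (SP-UAS) if there exists $\beta\in\mathcal{KL}$ such that for any $\Delta,\nu>0$ there exists $T^*>0$ such that for all $k_\circ\ge0$, $|y_\circ|\le\Delta$, $T\in(0,T^* )$ and $k\ge k_\circ$: $|\phi_T^y(k,k_\circ,y_\circ)|\le\max\{\beta(|y_\circ|,(k-k_\circ)T),\nu\}$.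 It is uniformly globally asymptotically stable (UGAS) if there exist $\beta\in\mathcal{KL}$ and $T^*>0$ such that for all $k_\circ\ge0$, $y_\circ\in\mathbb{R}^n$, $T\in(0,T^* )$ and $k\ge k_\circ$: $|\phi_T^y(k,k_\circ,y_\circ)|\le\beta(|y_\circ|,(k-k_\circ)T)$. USB / UGB. The family $y(k+1)=F_T(k,y(k))$ is uniformly semiglobally bounded (USB) if there exist $\kappa\in\mathcal{K}_\infty$ and a constant $c$ such that for any $\Delta>0$ there exists $T^*>0$ such that for all $k_\circ\ge0$, $|y_\circ|\le\Delta$, $T\in(0,T^* )$ and $k\ge k_\circ$: $|\phi_T^y(k,k_\circ,y_\circ)|\le\kappa(|y_\circ|)+c$. It is uniformly globally bounded (UGB) if there exist $\kappa\in\mathcal{K}_\infty$, $c$ and $T^*>0$ such that this inequality holds for all $k_\circ\ge0$, $y_\circ\in\mathbb{R}^n$, $T\in(0,T^* )$ and $k\ge k_\circ$. Lyapunov SP-UAS / Lyapunov UGAS. The family $y(k+1)=F_T(k,y(k))$ is Lyapunov SP-UAS if there exist $\alpha_1,\alpha_2\in\mathcal{K}_\infty$, $\alpha_3\in\mathcal{K}$, $L\in\mathcal{N}$ and, for each pair $\Delta,\nu>0$, there exist $T^*>0$ and for each $T\in(0,T^* )$ a continuous function $V_T:\mathbb{R}_{\ge0}\times\mathbb{R}^n\to\mathbb{R}_{\ge0}$ such that for all $|y|\le\Delta$, $k\ge0$ and $T\in(0,T^* )$, $$\alpha_1(|y|)\le V_T(k,y)\le\alpha_2(|y|),\qquad V_T(k+1,F_T(k,y))-V_T(k,y)\le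 -T(\alpha_3(|y|)-\nu),$$ and for all $r,s$ with $\max\{|r|,|s|\}\le\Delta$, all $T\in(0,T^* )$ and $k\ge0$, $$|V_T(k,r)-V_T(k,s)|\le L(\max\{|r|,|s|\})\,|r-s|.$$ It is Lyapunov UGAS if there exist $\alpha_1,\alpha_2\in\mathcal{K}_\infty$, $\alpha_3\in\mathcal{K}$, $L\in\mathcal{N}$, $T^*>0$ and for each $T\in(0,T^* )$ a continuous $V_T:\mathbb{R}_{\ge0}\times\mathbb{R}^n\to\mathbb{R}_{\ge0}$ such that these conditions hold for all $y,r,s\in\mathbb{R}^n$, $k\ge0$, $T\in(0,T^* )$ and with $\nu=0$. *)

(* Defs.v *)
From HB Require Import structures.
From mathcomp Require Import all_boot all_order all_algebra.
From mathcomp Require Import all_classical all_reals topology normedtype.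
Set Implicit Arguments.
Unset Strict Implicit.
Unset Printing Implicit Defensive.
Import Order.TTheory GRing.Theory Num.Theory.
Import numFieldNormedType.Exports.
Local Open Scope classical_set_scope.
Local Open Scope ring_scope.

(* Explicit, because the norm `|_| that the library puts on matrices is the
   sup norm. *)
Definition enorm (R : realType) (n : nat) (y : 'cV[R]_n) : R :=
  Num.sqrt (\sum_(i < n) y i ord0 ^+ 2).

(* A comparison function R_{>=0} -> R_{>=0} is represented by a function
   R -> R of which only the values on `[0, +oo[ are ever constrained.
   Nonnegativity there follows from a 0 = 0 and monotonicity for class K. *)
Definition class_K (R : realType) (a : R -> R) : Prop :=
  [/\ {within `[0, +oo[, continuous a},
      {in Num.nneg &, {homo a : r s / r < s}}
    & a 0 = 0].

Definition class_Kinfty (R : realType) (a : R -> R) : Prop :=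
  class_K a /\ forall M : R, exists2 s : R, 0 <= s & M < a s.

Definition class_N (R : realType) (g : R -> R) : Prop :=
  [/\ {within `[0, +oo[, continuous g},
      {in Num.nneg &, {homo g : r s / r <= s}}
    & forall s : R, 0 <= s -> 0 <= g s].

Definition class_KL (R : realType) (b : R -> R -> R) : Prop :=
  (forall t : R, 0 <= t -> class_K (fun s => b s t)) /\
  (forall s : R, 0 < s ->
     {in Num.nneg &, {homo b s : t u / t < u >-> u < t}} /\
     b s t @[t --> +oo] --> (0 : R)).

(* The family y(k+1) = F_T(k, y(k)); only the members F T with T > 0 matter. *)
Definition dt_family (R : realType) (n : nat) : Type :=
  R -> nat -> 'cV[R]_n -> 'cV[R]_n.

Fixpoint iter_from (T : Type) (G : nat -> T -> T) (k0 : nat) (y0 : T)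
    (j : nat) : T :=
  if j is j'.+1 then G (k0 + j')%N (iter_from G k0 y0 j') else y0.

(* phi_T(k, k0, y0); meaningful for k0 <= k. *)
Definition solution (R : realType) (n : nat) (F : dt_family R n) (T : R)
    (k k0 : nat) (y0 : 'cV[R]_n) : 'cV[R]_n :=
  iter_from (F T) k0 y0 (k - k0).

Definition SP_UAS (R : realType) (n : nat) (F : dt_family R n) : Prop :=
  exists2 beta : R -> R -> R, class_KL beta &
  forall Delta nu : R, 0 < Delta -> 0 < nu ->
  exists2 Tstar : R, 0 < Tstar &
  forall (k0 : nat) (y0 : 'cV[R]_n) (T : R) (k : nat),
    enorm y0 <= Delta -> 0 < T -> T < Tstar -> (k0 <= k)%N ->
    enorm (solution F T k k0 y0) <=
      Num.max (beta (enorm y0) ((k - k0)%:R * T)) nu.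

Definition UGAS (R : realType) (n : nat) (F : dt_family R n) : Prop :=
  exists2 beta : R -> R -> R, class_KL beta &
  exists2 Tstar : R, 0 < Tstar &
  forall (k0 : nat) (y0 : 'cV[R]_n) (T : R) (k : nat),
    0 < T -> T < Tstar -> (k0 <= k)%N ->
    enorm (solution F T k k0 y0) <= beta (enorm y0) ((k - k0)%:R * T).

Definition USB (R : realType) (n : nat) (F : dt_family R n) : Prop :=
  exists kappa : R -> R, exists c : R, class_Kinfty kappa /\
  forall Delta : R, 0 < Delta ->
  exists2 Tstar : R, 0 < Tstar &
  forall (k0 : nat) (y0 : 'cV[R]_n) (T : R) (k : nat),
    enorm y0 <= Delta -> 0 < T -> T < Tstar -> (k0 <= k)%N ->
    enorm (solution F T k k0 y0) <= kappa (enorm y0) + c.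

Definition UGB (R : realType) (n : nat) (F : dt_family R n) : Prop :=
  exists kappa : R -> R, exists c : R, class_Kinfty kappa /\
  exists2 Tstar : R, 0 < Tstar &
  forall (k0 : nat) (y0 : 'cV[R]_n) (T : R) (k : nat),
    0 < T -> T < Tstar -> (k0 <= k)%N ->
    enorm (solution F T k k0 y0) <= kappa (enorm y0) + c.

(* A continuous map R_{>=0} x R^n -> R_{>=0}. *)
Definition continuous_nonneg (R : realType) (n : nat)
    (V : R -> 'cV[R]_n -> R) : Prop :=
  {within [set p : R * 'cV[R]_n | 0 <= p.1],
     continuous (fun p : R * 'cV[R]_n => V p.1 p.2)} /\
  forall (t : R) (y : 'cV[R]_n), 0 <= t -> 0 <= V t y.

Definition Lyapunov_SP_UAS (R : realType) (n : nat) (F : dt_family R n) :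
    Prop :=
  exists alpha1 alpha2 alpha3 L : R -> R,
  [/\ class_Kinfty alpha1, class_Kinfty alpha2, class_K alpha3 & class_N L] /\
  forall Delta nu : R, 0 < Delta -> 0 < nu ->
  exists2 Tstar : R, 0 < Tstar &
  exists V : R -> R -> 'cV[R]_n -> R,
  forall T : R, 0 < T -> T < Tstar ->
  [/\ continuous_nonneg (V T),
      (forall (k : nat) (y : 'cV[R]_n), enorm y <= Delta ->
         alpha1 (enorm y) <= V T k%:R y <= alpha2 (enorm y)),
      (forall (k : nat) (y : 'cV[R]_n), enorm y <= Delta ->
         V T k.+1%:R (F T k y) - V T k%:R y <=
           - (T * (alpha3 (enorm y) - nu)))
    & (forall (k : nat) (r s : 'cV[R]_n),
         Num.max (enorm r) (enorm s) <= Delta ->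
         `|V T k%:R r - V T k%:R s| <=
           L (Num.max (enorm r) (enorm s)) * enorm (r - s))].

Definition Lyapunov_UGAS (R : realType) (n : nat) (F : dt_family R n) :
    Prop :=
  exists alpha1 alpha2 alpha3 L : R -> R,
  [/\ class_Kinfty alpha1, class_Kinfty alpha2, class_K alpha3 & class_N L] /\
  exists2 Tstar : R, 0 < Tstar &
  exists V : R -> R -> 'cV[R]_n -> R,
  forall T : R, 0 < T -> T < Tstar ->
  [/\ continuous_nonneg (V T),
      (forall (k : nat) (y : 'cV[R]_n),
         alpha1 (enorm y) <= V T k%:R y <= alpha2 (enorm y)),
      (forall (k : nat) (y : 'cV[R]_n),
         V T k.+1%:R (F T k y) - V T k%:R y <= - (T * alpha3 (enorm y)))
    & (forall (k : nat) (r s : 'cV[R]_n),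
         `|V T k%:R r - V T k%:R s| <=
           L (Num.max (enorm r) (enorm s)) * enorm (r - s))].

Definition cascade (R : realType) (nx nz : nat)
    (f : R -> nat -> 'cV[R]_nx -> 'cV[R]_nz -> 'cV[R]_nx)
    (g : dt_family R nz) : dt_family R (nx + nz) :=
  fun T k xi =>
    col_mx (f T k (usubmx xi) (dsubmx xi)) (g T k (dsubmx xi)).

Definition zero_input (R : realType) (nx nz : nat)
    (f : R -> nat -> 'cV[R]_nx -> 'cV[R]_nz -> 'cV[R]_nx) : dt_family R nx :=
  fun T k x => f T k x 0.

(* Main.v *)
Require Import Defs.
From mathcomp Require Import all_boot all_order all_algebra lra ring.
From mathcomp Require Import all_classical all_reals topology normedtype.
Set Implicit Arguments.
Unset Strict Implicit.
Unset Printing Implicit Defensive.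
Import Order.TTheory GRing.Theory Num.Theory.
Import numFieldNormedType.Exports.
Local Open Scope classical_set_scope.
Local Open Scope ring_scope.

(* Both versions are instances of one statement about "all T in a member of a
   filter F": F = 0^'+ is the semiglobal case, the principal filter of an
   interval ]0, T0[ the global one.

   Boundedness confines a trajectory to a ball of radius M, on which the
   Lipschitz bound on V and the coupling bound give, for all T in a member of F,
     V(k+1) - V(k) <= - T (alpha3(|x|) - nu - G gamma3(|z|)),
     G = L(gamma1 M) gamma2(M).
   Once |z| is small, V thus decreases at rate at least alpha3(rho)/2 while
   |x| >= rho, and does not exceed alpha2(rho) + alpha3(rho) after a step from
   |x| < rho (as T < 1); with rho small this yields uniform stability and
   attraction times that depend on the size of the initial state and on the
   accuracy only.  The infimum psi(s, t) of the bounds valid from |xi| <= s after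
   time t is then monotone in s and t, tends to 0 as t -> +oo, and psi(s, 0)
   tends to 0 with s, so that it has a class KL majorant. *)

(** * Comparison functions of class K *)

Lemma class_K_lt (R : realType) (a : R -> R) (r s : R) :
  class_K a -> 0 <= r -> r < s -> a r < a s.
Proof.
move=> [_ mono _] r0 rs; apply: mono => //; rewrite nnegrE //.
exact: le_trans r0 (ltW rs).
Qed.

Lemma class_K_le (R : realType) (a : R -> R) (r s : R) :
  class_K a -> 0 <= r -> r <= s -> a r <= a s.
Proof.
move=> aK r0; rewrite le_eqVlt => /predU1P[-> //|rs].
exact/ltW/class_K_lt.
Qed.

Lemma class_K_ge0 (R : realType) (a : R -> R) (r : R) :
  class_K a -> 0 <= r -> 0 <= a r.
Proof. by move=> aK r0; case: (aK) => _ _ <-; exact: class_K_le. Qed.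

Lemma class_K_gt0 (R : realType) (a : R -> R) (r : R) :
  class_K a -> 0 < r -> 0 < a r.
Proof. by move=> aK r0; case: (aK) => _ _ <-; exact: class_K_lt. Qed.

Lemma class_K_near0 (R : realType) (a : R -> R) (e : R) :
  class_K a -> 0 < e -> \forall s \near 0^'+, a s < e.
Proof.
move=> [/continuous_within_itvcyP[_ a0] _ a00] e0.
rewrite a00 in a0; move/cvgrPdist_lt : a0 => /(_ _ e0).
apply: filterS => s; rewrite sub0r normrN; exact: le_lt_trans (ler_norm _).
Qed.

(* The last hypothesis is a Lipschitz bound on [s, s'] that may blow up as s
   tends to 0 and as s' tends to infinity. *)
Lemma class_K_intro (R : realType) (a B : R -> R) :
  a 0 = 0 ->
  (forall s s', 0 <= s -> s < s' -> a s < a s') ->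
  (forall e, 0 < e -> exists2 s, 0 < s & a s < e) ->
  (forall s s', 0 < s -> s <= s' -> 0 <= B s <= B s') ->
  (forall s s', 0 < s -> s <= s' -> a s' - a s <= B s' * (s' - s) / s) ->
  class_K a.
Proof.
move=> a0 alt asmall Bmono alip; split=> //; last first.
  by move=> r s; rewrite nnegrE => r0 _; exact: alt.
have ale s s' : 0 <= s -> s <= s' -> a s <= a s'.
  by move=> s0; rewrite le_eqVlt => /predU1P[->//|/(alt _ _ s0)/ltW].
apply/continuous_within_itvcyP; split=> [x|]; last first.
  rewrite a0; apply/cvgrPdist_lt => e e0.
  have [s s0 ase] := asmall _ e0.
  near=> t; rewrite sub0r normrN ger0_norm.
    apply: le_lt_trans ase; apply: ale.
      by near: t; exact: nbhs_right_ge.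
    by near: t; exact: nbhs_right_le.
  rewrite -a0; apply: ale => //; near: t; exact: nbhs_right_ge.
rewrite in_itv/= andbT => x0; apply/cvgrPdist_lt => e e0.
(* On the interval from [x / 2] to [2 * x] the hypothesis gives the Lipschitz constant
   [B (2 * x) / (x / 2)]; the added 1 keeps [C] positive. *)
pose C := B (2 * x) / (x / 2) + 1.
have C0 : 0 < C.
  rewrite ltr_wpDl//; apply: divr_ge0; last by lra.
  by have /andP[] := Bmono (2 * x) (2 * x) ltac:(lra) ltac:(lra).
have key s s' : x / 2 < s -> s <= s' -> s' < 2 * x ->
    `|s' - s| < e / C -> `|a s' - a s| < e.
  move=> xs ss' s'x.
  have s0 : 0 < s by lra.
  have ss : 0 <= s' - s by lra.
  rewrite (ger0_norm ss) ltr_pdivlMr// => d.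
  have as's : 0 <= a s' - a s by rewrite subr_ge0 ale// ltW.
  rewrite (ger0_norm as's); apply: le_lt_trans (alip _ _ s0 ss') _.
  apply: le_lt_trans d.
  rewrite mulrAC mulrC ler_wpM2l//.
  apply: le_trans (_ : B (2 * x) / (x / 2) <= _); last by rewrite lerDl.
  have /andP[Bs' Bs'x] := Bmono s' (2 * x) ltac:(lra) ltac:(lra).
  apply: ler_pM => //; first by rewrite invr_ge0 ltW.
  by rewrite lef_pV2 ?posrE; lra.
near=> t.
have xt : `|x - t| < e / C.
  by near: t; apply: cvgr_dist_lt; [exact: cvg_id|exact: divr_gt0].
have t1 : x / 2 < t by near: t; apply: lt_nbhsr; lra.
have t2 : t < 2 * x by near: t; apply: lt_nbhsl; lra.
have [tx|tx] := leP t x; first by apply: key => //; lra.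
by rewrite distrC; apply: key; rewrite 1?distrC//; lra.
Unshelve. all: by end_near. Qed.

(** * Class KL and the construction of a KL majorant *)

Lemma class_KL_le (R : realType) (b : R -> R -> R) (s s' t t' : R) :
  class_KL b -> 0 <= s -> s <= s' -> 0 < s' -> 0 <= t' -> t' <= t ->
  b s t <= b s' t'.
Proof.
move=> [bK bt] s0 ss' s'0 t'0 t't.
have t0 := le_trans t'0 t't.
apply: (@le_trans _ _ (b s' t)); first exact: class_K_le (bK _ t0) s0 ss'.
move: t't; rewrite le_eqVlt => /predU1P[->//|t't].
by have [mono _] := bt _ s'0; apply/ltW/mono; rewrite ?nnegrE.
Qed.

(* Every trapezoid r |-> min(1, 2 - r/s) on ]0, 2s] is Lipschitz in s away from
   0, so this supremum is a continuous majorant of phi, whatever the jumps of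
   phi.  At s = 0 the range of r is empty and the value is 0. *)
Definition trapezoid_sup (R : realType) (phi : R -> R) (s : R) : R :=
  sup [set x | x = 0 \/
    exists2 r, 0 < r <= 2 * s & x = phi r * Num.min 1 (2 - r / s)].

Lemma trapezoid_sup0 (R : realType) (phi : R -> R) : trapezoid_sup phi 0 = 0.
Proof.
rewrite /trapezoid_sup -[RHS]sup1; congr sup; apply/seteqP; split=> x /=.
  by case=> // -[r /andP[r0]]; rewrite mulr0 => /(lt_le_trans r0); rewrite ltxx.
by left.
Qed.

Lemma trapezoid_sup_le (R : realType) (phi : R -> R) (s b : R) : 0 <= b ->
  (forall r, 0 < r <= 2 * s -> phi r * Num.min 1 (2 - r / s) <= b) ->
  trapezoid_sup phi s <= b.
Proof.
by move=> b0 H; apply: ge_sup => [|x []]; [exists 0; left|move->|move=> [r /H + ->]].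
Qed.

Lemma trapezoid_bounds (R : realType) (r s : R) : 0 < r <= 2 * s ->
  0 <= Num.min 1 (2 - r / s) <= 1.
Proof.
move=> /andP[r0 rs]; have s0 : 0 < s by lra.
by rewrite ge_min lexx/= andbT le_min ler01 subr_ge0 ler_pdivrMr.
Qed.

Lemma trapezoid_sup_ub (R : realType) (phi : R -> R) (s r : R) :
  (forall r r', 0 < r -> r <= r' -> 0 <= phi r <= phi r') ->
  0 < r <= 2 * s ->
  phi r * Num.min 1 (2 - r / s) <= trapezoid_sup phi s.
Proof.
move=> mono rs; apply: ub_le_sup; last by right; exists r.
have s0 : 0 < 2 * s by case/andP: rs => [] /lt_le_trans; exact.
exists (phi (2 * s)) => _ [->|[u us ->]].
  by have /andP[] := mono (2 * s) (2 * s) s0 (lexx _).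
have /andP[u0 us'] := us; have /andP[p0 pp] := mono _ _ u0 us'.
have /andP[m0 m1] := trapezoid_bounds us.
by rewrite -[leRHS]mulr1; apply: ler_pM.
Qed.

Lemma trapezoid_sup_ge0 (R : realType) (phi : R -> R) (s : R) :
  (forall r r', 0 < r -> r <= r' -> 0 <= phi r <= phi r') ->
  0 < s -> 0 <= trapezoid_sup phi s.
Proof.
move=> mono s0; have rs : 0 < s <= 2 * s by lra.
apply: le_trans (trapezoid_sup_ub mono rs).
have /andP[m0 _] := trapezoid_bounds rs.
by apply: mulr_ge0 => //; have /andP[] := mono s s s0 (lexx _).
Qed.

(** The trapezoid has value 1 at [r = s]. *)
Lemma trapezoid_sup_ge (R : realType) (phi : R -> R) (s : R) :
  (forall r r', 0 < r -> r <= r' -> 0 <= phi r <= phi r') ->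
  0 < s -> phi s <= trapezoid_sup phi s.
Proof.
move=> mono s0; have rs : 0 < s <= 2 * s by lra.
have := trapezoid_sup_ub mono rs.
rewrite divff ?gt_eqF// (_ : 2 - 1 = 1); last by lra.
by rewrite minxx mulr1.
Qed.

Lemma trapezoid_sup_le_double (R : realType) (phi : R -> R) (s : R) :
  (forall r r', 0 < r -> r <= r' -> 0 <= phi r <= phi r') ->
  0 < s -> trapezoid_sup phi s <= phi (2 * s).
Proof.
move=> mono s0; apply: trapezoid_sup_le => [|r rs].
  by have /andP[] := mono (2 * s) (2 * s) ltac:(lra) (lexx _).
have /andP[r0 rs'] := rs; have /andP[p0 pp] := mono _ _ r0 rs'.
have /andP[m0 m1] := trapezoid_bounds rs.
by rewrite -[leRHS]mulr1; apply: ler_pM.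
Qed.

(** For fixed [r] the weight grows with [s], because [r / s] decreases, and so does the range of
    [r]. *)
Lemma trapezoid_sup_mono (R : realType) (phi : R -> R) (s s' : R) :
  (forall r r', 0 < r -> r <= r' -> 0 <= phi r <= phi r') ->
  0 < s -> s <= s' -> trapezoid_sup phi s <= trapezoid_sup phi s'.
Proof.
move=> mono s0 ss'; apply: trapezoid_sup_le => [|r rs].
  by apply: trapezoid_sup_ge0 => //; lra.
have /andP[r0 rs'] := rs.
have r2s' : 0 < r <= 2 * s' by lra.
apply: le_trans (trapezoid_sup_ub mono r2s').
apply: ler_wpM2l; first by have /andP[] := mono r r r0 (lexx _).
apply: le_min2 => //; rewrite lerD2l lerN2 ler_pM2l//.
by rewrite lef_pV2 ?posrE//; lra.
Qed.

(** Since [r <= 2 * s'], the weight of [r] gains at most [2 * (s' - s) / s] in passing from [s] to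
    [s'], and [phi r <= phi (2 * s')]. A point [r > 2 * s], absent from the supremum at [s], counts
    there with weight 0. *)
Lemma trapezoid_sup_lip (R : realType) (phi : R -> R) (s s' : R) :
  (forall r r', 0 < r -> r <= r' -> 0 <= phi r <= phi r') ->
  0 < s -> s <= s' ->
  trapezoid_sup phi s' - trapezoid_sup phi s <=
    2 * phi (2 * s') * (s' - s) / s.
Proof.
move=> mono s0 ss'; have s'0 : 0 < s' by lra.
have [p0 _] := andP (mono (2 * s') (2 * s') ltac:(lra) (lexx _)).
have C0 : 0 <= 2 * phi (2 * s') * (s' - s) / s.
  by rewrite divr_ge0 ?mulr_ge0//; lra.
have T0 := trapezoid_sup_ge0 mono s0.
rewrite lerBlDl; apply: trapezoid_sup_le => [|r /andP[r0 rs]].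
  exact: addr_ge0.
have [pr0 prs] := andP (mono _ _ r0 rs).
have D0 : 0 <= 2 * (s' - s) / s by rewrite divr_ge0 ?mulr_ge0//; lra.
have dd : r / s - r / s' <= 2 * (s' - s) / s.
  rewrite -mulrBr (_ : s^-1 - s'^-1 = (s' - s) / (s * s')); last first.
    by field; rewrite !gt_eqF.
  rewrite invfM mulrA mulrC mulrA -subr_ge0.
  rewrite (_ : _ - _ = (2 * s' - r) * (s' - s) / (s * s')).
    by rewrite divr_ge0 ?mulr_ge0//; lra.
  by field; rewrite !gt_eqF.
have step m : Num.min 1 (2 - r / s') <= m + 2 * (s' - s) / s ->
    phi r * m <= trapezoid_sup phi s ->
    phi r * Num.min 1 (2 - r / s') <=
      trapezoid_sup phi s + 2 * phi (2 * s') * (s' - s) / s.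
  move=> mm pm; apply: le_trans (ler_wpM2l pr0 mm) _.
  rewrite mulrDr lerD// (_ : 2 * _ * _ / _ = phi (2 * s') * (2 * (s' - s) / s)).
    by rewrite ler_wpM2r.
  by ring.
have [rs2|rs2] := leP r (2 * s).
  apply: (step (Num.min 1 (2 - r / s))).
    by rewrite -lerBlDr le_min; apply/andP; split;
      [rewrite lerBlDr ge_min; apply/orP; left; lra|
       rewrite lerBlDr ge_min; apply/orP; right; lra].
  by apply: trapezoid_sup_ub => //; lra.
apply: (step 0); last by rewrite mulr0.
have : 2 < r / s by rewrite ltr_pdivlMr.
by rewrite ge_min => ?; apply/orP; right; lra.
Qed.

(** [P s t e] is to be read: [e] bounds whatever starts within [s], from time [t] on. The trapezoid
    supremum makes the infimum of such [e] continuous in [s]. The added term [s / (1 + t)] makes the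
    result strictly monotone in both arguments and puts it strictly above the infimum, which need
    not be attained. *)
Lemma class_KL_majorant (R : realType) (P : R -> R -> R -> Prop) :
  (forall s s' t e, s <= s' -> P s' t e -> P s t e) ->
  (forall s t t' e, t <= t' -> P s t e -> P s t' e) ->
  (forall s t e e', e <= e' -> P s t e -> P s t e') ->
  (forall s, 0 < s -> exists e, P s 0 e) ->
  (forall e, 0 < e -> exists2 s, 0 < s & P s 0 e) ->
  (forall s e, 0 < s -> 0 < e -> exists2 t, 0 <= t & P s t e) ->
  exists2 beta : R -> R -> R, class_KL beta &
    forall s t, 0 < s -> 0 <= t -> P s t (beta s t).
Proof.
move=> Ps Pt Pe Pbnd Psmall Pattr.
pose psi t s := inf [set e | 0 <= e /\ P s t e].
have psi_inf s t : 0 < s -> 0 <= t -> [set e | 0 <= e /\ P s t e] !=set0.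
  move=> s0 t0; have [e Pse] := Pbnd _ s0.
  exists (Num.max 0 e) => /=; split; first by rewrite le_max lexx.
  by apply: Pe (Pt _ _ _ _ t0 Pse); rewrite le_max lexx orbT.
have psi_lb s t e : 0 <= e -> P s t e -> psi t s <= e.
  by move=> e0 Pse; apply: ge_inf; [exists 0 => x []|split].
have psi_ge0 s t : 0 < s -> 0 <= t -> 0 <= psi t s.
  by move=> s0 t0; apply: lb_le_inf; [exact: psi_inf|move=> x []].
have psiP s t e : 0 < s -> 0 <= t -> psi t s < e -> P s t e.
  move=> s0 t0 /inf_lt[|x [_ Px] /ltW xe]; first exact: psi_inf.
  exact: Pe xe Px.
have psi_s t : 0 <= t ->
    forall s s', 0 < s -> s <= s' -> 0 <= psi t s <= psi t s'.
  move=> t0 s s' s0 ss'; rewrite psi_ge0//=; apply: lb_le_inf.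
    by apply: psi_inf => //; lra.
  by move=> e /= [e0 Pse]; apply: psi_lb => //; exact: Ps Pse.
have psi_t s t t' : 0 < s -> 0 <= t -> t <= t' -> psi t' s <= psi t s.
  move=> s0 t0 tt'; apply: lb_le_inf; first exact: psi_inf.
  by move=> e /= [e0 Pse]; apply: psi_lb => //; exact: Pt Pse.
pose beta s t := trapezoid_sup (psi t) s + s / (1 + t).
exists beta; last first.
  move=> s t s0 t0; apply: psiP => //.
  apply: le_lt_trans (trapezoid_sup_ge (psi_s _ t0) s0) _.
  by rewrite ltrDl divr_gt0//; lra.
split=> [t t0|s s0].
  have t1 : 0 < (1 + t)^-1 by rewrite invr_gt0; lra.
  (* The first summand comes from [trapezoid_sup_lip]; the second bounds the slope [1 / (1 + t)] of
     the linear term, as [s' / s >= 1]. *)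
  apply: (@class_K_intro _ _ (fun s => 2 * psi t (2 * s) + s / (1 + t))).
  - by rewrite /beta trapezoid_sup0 mul0r addr0.
  - move=> s s'; rewrite le_eqVlt => /predU1P[<- s'0|s0 ss'].
      rewrite /beta trapezoid_sup0 mul0r addr0 ltr_wpDl//.
        by apply: trapezoid_sup_ge0 => //; exact: psi_s.
      by rewrite mulr_gt0.
    rewrite /beta ler_ltD ?ltr_pM2r//.
    by apply: trapezoid_sup_mono => //; [exact: psi_s|exact: ltW].
  - move=> e e0; have [s s0 Pse] := Psmall (e / 2) ltac:(lra).
    (* The supremum at [s'] involves [psi t] up to [2 * s'], hence [s / 2]; [e / 4] controls the
       linear term. *)
    pose s' := Num.min (s / 2) (e / 4).
    have s'0 : 0 < s' by rewrite lt_min; apply/andP; split; lra.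
    have s's : s' <= s / 2 by rewrite ge_min lexx.
    have s'e : s' <= e / 4 by rewrite ge_min lexx orbT.
    exists s' => //; rewrite /beta.
    have h1 : trapezoid_sup (psi t) s' <= e / 2.
      apply: le_trans (trapezoid_sup_le_double (psi_s _ t0) s'0) _.
      apply: psi_lb; first by lra.
      by apply: (Ps _ s); [lra|exact: Pt t0 Pse].
    have h2 : s' / (1 + t) <= s'.
      by rewrite ler_pdivrMr ?mulrDr ?mulr1 ?lerDl ?mulr_ge0//; lra.
    lra.
  - move=> s s' s0 ss'.
    have [p0 pp] := andP (psi_s _ t0 (2 * s) (2 * s') ltac:(lra) ltac:(lra)).
    have q0 : 0 <= s / (1 + t) by rewrite mulr_ge0// ltW.
    have qq : s / (1 + t) <= s' / (1 + t) by rewrite ler_pM2r.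
    by apply/andP; split; lra.
  move=> s s' s0 ss'; have lip := trapezoid_sup_lip (psi_s _ t0) s0 ss'.
  have h : s' / (1 + t) - s / (1 + t) <= s' / (1 + t) * ((s' - s) / s).
    rewrite -mulrBl [leRHS](_ : _ = (s' - s) / (1 + t) * (s' / s)); last by ring.
    apply: ler_peMr; first by rewrite divr_ge0; lra.
    by rewrite ler_pdivlMr ?mul1r.
  rewrite /beta [leRHS](_ : _ = 2 * psi t (2 * s') * (s' - s) / s +
    s' / (1 + t) * ((s' - s) / s)); first by lra.
  by ring.
split=> [t u|].
  rewrite !nnegrE => t0 u0 tu; rewrite /beta ler_ltD//.
    apply: trapezoid_sup_le => [|r rs].
      by apply: trapezoid_sup_ge0 => //; exact: psi_s.
    apply: le_trans (trapezoid_sup_ub (psi_s _ t0) rs).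
    have /andP[m0 _] := trapezoid_bounds rs.
    by case/andP: rs => r0 _; rewrite ler_wpM2r// psi_t// ltW.
  by rewrite ltr_pM2l// ltf_pV2 ?posrE; lra.
apply/cvgrPdist_lt => e e0.
(* The size is [2 * s] because [trapezoid_sup (psi t) s <= psi t (2 * s)]. *)
have [t1 t10 Pt1] := Pattr (2 * s) (e / 2) ltac:(lra) ltac:(lra).
near=> t.
have tt1 : t1 <= t by near: t; apply: nbhs_pinfty_ge; rewrite num_real.
have t0 : 0 <= t by lra.
have h1 : trapezoid_sup (psi t) s <= e / 2.
  apply: le_trans (trapezoid_sup_le_double (psi_s _ t0) s0) _.
  apply: psi_lb; first by lra.
  exact: Pt tt1 Pt1.
have h2 : 2 * s / e < t by near: t; apply: nbhs_pinfty_gt; rewrite num_real.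
have h3 : s / (1 + t) < e / 2.
  rewrite ltr_pdivrMr; last by lra.
  by move: h2; rewrite ltr_pdivrMr//; nra.
have h4 : 0 <= trapezoid_sup (psi t) s.
  by apply: trapezoid_sup_ge0 => //; exact: psi_s.
have h5 : 0 <= s / (1 + t) by rewrite divr_ge0; lra.
rewrite sub0r normrN ger0_norm /beta; lra.
Unshelve. all: by end_near. Qed.

(** * From bounds along a filter of sampling periods to a KL estimate *)

Definition near_bound (R : realType) (F : set_system R) (n : nat)
    (Phi : dt_family R n) (s t e : R) : Prop :=
  \forall T \near F, forall k0 y0 j, enorm y0 <= s -> t <= j%:R * T ->
    enorm (iter_from (Phi T) k0 y0 j) <= e.

(* With F the filter 0^'+ this is the estimate defining SP_UAS; with F the
   principal filter of an interval ]0, T0[ it is equivalent to the one defining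
   UGAS. *)
Definition near_KL_bound (R : realType) (F : set_system R) (n : nat)
    (Phi : dt_family R n) (beta : R -> R -> R) : Prop :=
  forall Delta nu : R, 0 < Delta -> 0 < nu ->
  \forall T \near F, forall k0 y0 j, enorm y0 <= Delta ->
    enorm (iter_from (Phi T) k0 y0 j) <=
      Num.max (beta (enorm y0) (j%:R * T)) nu.

(** Covers the initial sizes between [d] and [Delta] by finitely many cells, so that finitely many
    members of the filter need to be intersected. *)
Lemma dyadic_bracket (R : realDomainType) (d s : R) (n : nat) :
  d < s -> s <= d * 2 ^+ n ->
  exists2 i, (i < n)%N & d * 2 ^+ i <= s <= 2 * (d * 2 ^+ i).
Proof.
move=> ds; elim: n => [|n IH] sn; first by move: sn; rewrite expr0 mulr1; lra.
have [/IH[i ni ?]|ns] := leP s (d * 2 ^+ n).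
  by exists i => //; exact: ltn_trans ni _.
by exists n => //; rewrite (ltW ns) mulrCA -exprS.
Qed.

(** The member of [F] in each hypothesis depends on the size, time and accuracy, whereas
    [near_KL_bound] needs one member for all times. Small initial states and late times are covered
    by [nu]. The remaining box of sizes and times is cut into finitely many cells, and on each the
    bound is [beta] at the smallest size and the largest time, where it is least. *)
Lemma near_KL_boundI (R : realType) (F : set_system R) (FF : Filter F)
    (n : nat) (Phi : dt_family R n) :
  (\forall T \near F, 0 < T) ->
  (forall s, 0 < s -> exists e, near_bound F Phi s 0 e) ->
  (forall e, 0 < e -> exists2 s, 0 < s & near_bound F Phi s 0 e) ->
  (forall s e, 0 < s -> 0 < e -> exists2 t, 0 <= t & near_bound F Phi s t e) ->
  exists2 beta, class_KL beta & near_KL_bound F Phi beta.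
Proof.
move=> FT Pbnd Psmall Pattr.
have Ple s s' t t' e e' : s <= s' -> t' <= t -> e' <= e ->
    near_bound F Phi s' t' e' -> near_bound F Phi s t e.
  move=> ss' tt' ee'; apply: filterS => T PT k0 y0 j ys tj.
  by apply: le_trans ee'; apply: PT; [exact: le_trans ss'|exact: le_trans tj].
(* The margins 2 and 1 leave room for covering a box of pairs (s, t) by
   finitely many cells, T being uniform on each cell only. *)
have [|||s s0|e e0|s e s0 e0|beta betaKL betaP] :=
  @class_KL_majorant R (fun s t e => near_bound F Phi (2 * s) (Num.max 0 (t - 1)) e).
- by move=> s s' t e ss'; apply: Ple => //; lra.
- by move=> s t t' e tt'; apply: Ple => //; rewrite le_max2// lerD2r.
- by move=> s t e e' ee'; apply: Ple.
- have [e Pe] := Pbnd (2 * s) ltac:(lra); exists e.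
  by apply: Ple Pe => //; rewrite le_max lexx.
- have [s s0 Pe] := Psmall e e0; exists (s / 2); first by lra.
  by apply: Ple Pe => //; [lra|rewrite le_max lexx].
- have [t t0 Pt] := Pattr (2 * s) e ltac:(lra) e0; exists (t + 1); first by lra.
  by apply: Ple Pt => //; rewrite le_max; apply/orP; right; lra.
exists beta => // Delta nu Delta0 nu0.
have [d d0 Pd] := Psmall nu nu0.
have [tau tau0 Ptau] := Pattr Delta nu Delta0 nu0.
(* [N] dyadic sizes reach [Delta] because [n < 2 ^ n]; [M] unit intervals of time reach [tau]. *)
pose N := (Num.truncn (Delta / d)).+1; pose M := (Num.truncn tau).+1.
have DN : Delta <= d * 2 ^+ N.
  rewrite mulrC -ler_pdivrMr//; apply/ltW; apply: lt_trans (truncnS_gt _) _.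
  by rewrite -natrX ltr_nat ltn_expl.
have cells : \forall T \near F, forall (p : 'I_N * 'I_M) k0 y0 j,
    enorm y0 <= 2 * (d * 2 ^+ p.1) -> p.2%:R <= j%:R * T ->
    enorm (iter_from (Phi T) k0 y0 j) <= beta (d * 2 ^+ p.1) p.2.+1%:R.
  apply: filter_forall => -[i l] /=.
  have := betaP (d * 2 ^+ i) l.+1%:R; rewrite mulr_gt0 ?exprn_gt0//.
  move=> /(_ isT (ler0n _ _)); apply: filterS => T PT k0 y0 j yd lj.
  by apply: PT => //; rewrite -natr1 addrK max_r.
near=> T; move=> k0 y0 j yD.
have T0 : 0 < T by near: T.
have jT0 : 0 <= j%:R * T by rewrite mulr_ge0// ltW.
rewrite le_max; have [yd|dy] := leP (enorm y0) d.
  by apply/orP; right; move: k0 y0 j yd jT0 {yD}; near: T.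
have [tj|jt] := leP tau (j%:R * T).
  by apply/orP; right; move: k0 y0 j yD tj {dy jT0}; near: T.
apply/orP; left.
have [i iN /andP[iy yi]] := dyadic_bracket dy (le_trans yD DN).
have [l1 l2] := andP (truncn_itv jT0).
have lM : (Num.truncn (j%:R * T) < M)%N.
  by rewrite ltnS le_truncn// ltW.
have := near cells T => /(_ _ (Ordinal iN, Ordinal lM) k0 y0 j yi l1) /=.
move=> H; apply: le_trans (H _) _; first by [].
apply: class_KL_le => //; last exact: ltW.
- by rewrite mulr_ge0 ?exprn_ge0// ltW.
- exact: lt_trans dy.
Unshelve. all: by end_near. Qed.

(** * The Euclidean norm of stacked vectors *)

Lemma enorm_ge0 (R : realType) (n : nat) (y : 'cV[R]_n) : 0 <= enorm y.
Proof. exact: sqrtr_ge0. Qed.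

Lemma enorm_sqr (R : realType) (n : nat) (y : 'cV[R]_n) :
  enorm y ^+ 2 = \sum_(i < n) y i ord0 ^+ 2.
Proof. by rewrite sqr_sqrtr// sumr_ge0// => i _; exact: sqr_ge0. Qed.

Lemma enorm_col_mx_sqr (R : realType) (m n : nat) (x : 'cV[R]_m)
    (z : 'cV[R]_n) : enorm (col_mx x z) ^+ 2 = enorm x ^+ 2 + enorm z ^+ 2.
Proof.
rewrite !enorm_sqr big_split_ord/=; congr (_ + _); apply: eq_bigr => i _.
  by rewrite col_mxEu.
by rewrite col_mxEd.
Qed.

Lemma enorm_col_mx_ge (R : realType) (m n : nat) (x : 'cV[R]_m)
    (z : 'cV[R]_n) :
  enorm x <= enorm (col_mx x z) /\ enorm z <= enorm (col_mx x z).
Proof.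
by split; rewrite -(@ler_pXn2r _ 2)// ?nnegrE ?enorm_ge0// enorm_col_mx_sqr;
  rewrite ?lerDl ?lerDr sqr_ge0.
Qed.

Lemma enorm_col_mx_le (R : realType) (m n : nat) (x : 'cV[R]_m)
    (z : 'cV[R]_n) : enorm (col_mx x z) <= enorm x + enorm z.
Proof.
have x0 := enorm_ge0 x; have z0 := enorm_ge0 z.
rewrite -(@ler_pXn2r _ 2)// ?nnegrE ?enorm_ge0 ?addr_ge0// enorm_col_mx_sqr.
by have := mulr_ge0 x0 z0; nra.
Qed.

Lemma enorm_col_mx0 (R : realType) (m n : nat) (x : 'cV[R]_m) :
  enorm (col_mx x (0 : 'cV[R]_n)) = enorm x.
Proof.
apply/eqP; rewrite -(@eqrXn2 _ 2)// ?enorm_ge0// enorm_col_mx_sqr.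
rewrite [X in _ + X]enorm_sqr big1 ?addr0// => i _.
by rewrite mxE expr0n.
Qed.

(** * Trajectories of the cascade and decay of the Lyapunov function *)

Lemma iter_fromD (T : Type) (G : nat -> T -> T) (k0 : nat) (y : T) (i j : nat) :
  iter_from G k0 y (i + j) = iter_from G (k0 + i) (iter_from G k0 y i) j.
Proof. by elim: j => [|j IH]; rewrite ?addn0// addnS/= IH addnA. Qed.

Lemma dsubmx_iter_cascade (R : realType) (nx nz : nat)
    (f : R -> nat -> 'cV[R]_nx -> 'cV[R]_nz -> 'cV[R]_nx)
    (g : dt_family R nz) (T : R) (k0 : nat) (xi : 'cV[R]_(nx + nz)) (j : nat) :
  dsubmx (iter_from (cascade f g T) k0 xi j) =
  iter_from (g T) k0 (dsubmx xi) j.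
Proof. by elim: j => //= j <-; rewrite col_mxKd. Qed.

(** Below [w] the sequence stays below [w], since [d >= 0]; until then the drops accumulate. *)
Lemma le_max_decrease (R : realDomainType) (v : nat -> R) (w d : R) : 0 <= d ->
  (forall j, v j.+1 <= Num.max w (v j - d)) ->
  forall j, v j <= Num.max w (v 0%N - j%:R * d).
Proof.
move=> d0 step; elim=> [|j IH]; first by rewrite mul0r subr0 le_max lexx orbT.
apply: le_trans (step j) _; rewrite ge_max !le_max lexx/=.
move: IH; rewrite le_max -natr1 mulrDl mul1r => /orP[h|h]; apply/orP; lra.
Qed.

(** One estimate for both stability and attraction: its last premise holds for every [j] if [xi] is
    small, and for every bounded [xi] once [j%:R * T] is large. Neither [eta] nor [d] depends on
    [T]. *)
Lemma cascade_decay (R : realType) (F : set_system R) (FF : Filter F)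
    (nx nz : nat) (f : R -> nat -> 'cV[R]_nx -> 'cV[R]_nz -> 'cV[R]_nx)
    (g : dt_family R nz) (gamma1 gamma2 gamma3 alpha1 alpha2 alpha3 L : R -> R) :
  class_K gamma1 -> class_N gamma2 -> class_K gamma3 ->
  class_K alpha1 -> class_K alpha2 -> class_K alpha3 -> class_N L ->
  (\forall T \near F, 0 < T < 1) ->
  (\forall T \near F, forall k x z,
     enorm (f T k x z) <= gamma1 (enorm (col_mx x z))) ->
  (\forall T \near F, forall k x z,
     enorm (f T k x z - f T k x 0) <=
       T * gamma2 (enorm x) * gamma3 (enorm z)) ->
  (forall Delta nu, 0 < Delta -> 0 < nu -> \forall T \near F,
     exists V : nat -> 'cV[R]_nx -> R,
     [/\ forall k y, enorm y <= Delta ->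
           alpha1 (enorm y) <= V k y <= alpha2 (enorm y),
         forall k y, enorm y <= Delta ->
           V k.+1 (f T k y 0) - V k y <= - (T * (alpha3 (enorm y) - nu))
       & forall k r s, Num.max (enorm r) (enorm s) <= Delta ->
           `|V k r - V k s| <=
             L (Num.max (enorm r) (enorm s)) * enorm (r - s)]) ->
  forall M e, 0 < M -> 0 < e ->
  exists2 eta, 0 < eta & exists2 d, 0 < d &
  \forall T \near F, forall k0 xi j,
    let phi := iter_from (cascade f g T) k0 xi in
    (forall i, enorm (phi i) <= M) ->
    (forall i, enorm (dsubmx (phi i)) <= eta) ->
    alpha2 (enorm xi) - j%:R * T * d <= alpha1 (e / 2) ->
    enorm (phi j) <= e.
Proof.
move=> g1K [_ g2mono g2ge0] g3K a1K a2K a3K [_ Lmono Lge0] FT Fgrowth Fcoupl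
  FV M e M0 e0.
have ae0 : 0 < alpha1 (e / 2) by apply: class_K_gt0 => //; lra.
(* The left side bounds [V] after a step from a state with norm below [rho]. *)
have [rho [rho0 rhoe]] : exists rho, 0 < rho /\
    alpha2 rho + alpha3 rho <= alpha1 (e / 2).
  suff : \forall r \near 0^'+, 0 < r /\ alpha2 r + alpha3 r <= alpha1 (e / 2).
    by move/filter_ex.
  near=> r; split; first by near: r; exact: nbhs_right_gt.
  have : alpha2 r < alpha1 (e / 2) / 2.
    by near: r; apply: class_K_near0 => //; lra.
  have : alpha3 r < alpha1 (e / 2) / 2.
    by near: r; apply: class_K_near0 => //; lra.
  by lra.
have a3rho : 0 < alpha3 rho by exact: class_K_gt0.
have Gge0 : 0 <= L (gamma1 M) * gamma2 M.
  by rewrite mulr_ge0 ?Lge0 ?g2ge0 ?class_K_ge0// ltW.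
set G := L (gamma1 M) * gamma2 M in Gge0.
(* Half of [e] is left to each component, and the coupling costs at most [T * (alpha3 rho / 4)] per
   step. *)
have [eta [eta0 etae Geta]] : exists eta, [/\ 0 < eta, eta <= e / 2 &
    G * gamma3 eta <= alpha3 rho / 4].
  suff : \forall r \near 0^'+, [/\ 0 < r, r <= e / 2 &
      G * gamma3 r <= alpha3 rho / 4] by move/filter_ex.
  near=> r; split.
  - by near: r; exact: nbhs_right_gt.
  - by near: r; apply: nbhs_right_le; lra.
  have g3r : gamma3 r < alpha3 rho / 4 / (G + 1).
    by near: r; apply: class_K_near0 => //; rewrite divr_gt0//; lra.
  move: g3r; rewrite ltr_pdivlMr; last by lra.
  have : 0 <= gamma3 r.
    by apply: class_K_ge0 => //; near: r; exact: nbhs_right_ge.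
  by nra.
(* Of the rate [alpha3 rho], one quarter is lost to [nu] and one to the coupling. *)
exists eta => //; exists (alpha3 rho / 2); first by lra.
(* The ball has to contain the states and their images under [f], with and without the input [z],
   since [V] is compared at these images. *)
pose Delta := Num.max M (gamma1 M).
have MD : M <= Delta by rewrite le_max lexx.
have gMD : gamma1 M <= Delta by rewrite le_max lexx orbT.
have Delta0 : 0 < Delta by exact: lt_le_trans MD.
have FV' := FV Delta (alpha3 rho / 4) Delta0 ltac:(lra).
apply: filterS (filterI FT (filterI Fgrowth (filterI Fcoupl FV'))).
move=> T [/andP[T0 T1] [growth [coupl [V [Vbnd Vdecr Vlip]]]]].
move=> k0 xi j; set phi := iter_from _ _ _ => phiM phie alphaj.
pose x i := usubmx (phi i); pose z i := dsubmx (phi i).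
have phiE i : phi i = col_mx (x i) (z i) by rewrite vsubmxK.
have xM i : enorm (x i) <= M.
  by apply: le_trans (phiM i); rewrite phiE; case: (enorm_col_mx_ge (x i) (z i)).
have xS i : x i.+1 = f T (k0 + i)%N (x i) (z i) by rewrite /x /= col_mxKu.
pose v i := V (k0 + i)%N (x i).
have vstep i : v i.+1 <= v i - T * (alpha3 (enorm (x i)) - alpha3 rho / 2).
  rewrite /v addnS xS.
  have decr := Vdecr (k0 + i)%N (x i) (le_trans (xM i) MD).
  have b1 : enorm (f T (k0 + i)%N (x i) (z i)) <= gamma1 M.
    apply: le_trans (growth _ _ _) _; apply: class_K_le (enorm_ge0 _) _ => //.
    by rewrite -phiE.
  have b2 : enorm (f T (k0 + i)%N (x i) 0) <= gamma1 M.
    apply: le_trans (growth _ _ _) _; apply: class_K_le (enorm_ge0 _) _ => //.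
    by rewrite enorm_col_mx0.
  set r := f T (k0 + i)%N (x i) (z i) in b1 *.
  set s := f T (k0 + i)%N (x i) 0 in b2 decr.
  have maxM : Num.max (enorm r) (enorm s) <= gamma1 M by rewrite ge_max b1.
  have max0 : 0 <= Num.max (enorm r) (enorm s) by rewrite le_max enorm_ge0.
  have lip := Vlip (k0 + i).+1 r s (le_trans maxM gMD).
  have lipG : L (Num.max (enorm r) (enorm s)) * enorm (r - s) <=
      T * (alpha3 rho / 4).
    apply: (@le_trans _ _ (L (gamma1 M) * (T * gamma2 M * gamma3 eta))).
      apply: ler_pM => //; first exact: Lge0.
      - exact: enorm_ge0.
      - by apply: Lmono => //; rewrite nnegrE// class_K_ge0// ltW.
      apply: le_trans (coupl _ _ _) _.
      apply: ler_pM.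
      - by rewrite mulr_ge0 ?(ltW T0)// g2ge0// enorm_ge0.
      - by rewrite class_K_ge0// enorm_ge0.
      - rewrite ler_pM2l//; apply: g2mono; rewrite ?nnegrE ?enorm_ge0//.
        exact: ltW.
      - by apply: class_K_le (enorm_ge0 _) (phie i).
    rewrite [leLHS](_ : _ = T * (G * gamma3 eta)); last by rewrite /G; ring.
    by rewrite ler_pM2l.
  have := ler_norm (V (k0 + i).+1 r - V (k0 + i).+1 s).
  by lra.
(* Either [enorm (x i) >= rho] and [V] drops, or [V] starts below [alpha2 rho] and gains at most
   [alpha3 rho], as [T < 1]. *)
have vmax i : v i.+1 <= Num.max (alpha1 (e / 2)) (v i - T * (alpha3 rho / 2)).
  have vs := vstep i; rewrite le_max; apply/orP.
  have [rx|xr] := leP rho (enorm (x i)).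
    right; apply: le_trans vs _; rewrite lerD2l lerN2 ler_pM2l//.
    by have := class_K_le a3K (ltW rho0) rx; lra.
  left; apply: le_trans vs _; apply: le_trans rhoe.
  have [_ va2] := andP (Vbnd (k0 + i)%N (x i) (le_trans (xM i) MD)).
  have a2r := class_K_le a2K (enorm_ge0 _) (ltW xr).
  have a3x := class_K_ge0 a3K (enorm_ge0 (x i)).
  by rewrite /v; nra.
have Td0 : 0 <= T * (alpha3 rho / 2) by rewrite mulr_ge0; lra.
have vj := le_max_decrease Td0 vmax j.
have v0 : v 0%N <= alpha2 (enorm xi).
  rewrite /v addn0.
  have [_ va2] := andP (Vbnd k0 (x 0%N) (le_trans (xM _) MD)).
  apply: le_trans va2 _; apply: class_K_le (enorm_ge0 _) _ => //.
  by have [] := enorm_col_mx_ge (x 0%N) (z 0%N); rewrite -phiE.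
have vja : v j <= alpha1 (e / 2).
  apply: le_trans vj _; rewrite ge_max lexx/=.
  by rewrite mulrA; lra.
have xe : enorm (x j) <= e / 2.
  rewrite leNgt; apply/negP => ex.
  have [a1v _] := andP (Vbnd (k0 + j)%N (x j) (le_trans (xM _) MD)).
  have := class_K_lt a1K _ ex => /(_ ltac:(lra)).
  by rewrite /v in vja; lra.
rewrite phiE; apply: le_trans (enorm_col_mx_le _ _) _.
by have := phie j; rewrite -/(z j); lra.
Unshelve. all: by end_near. Qed.

(** Rounding a waiting time up to whole steps costs at most 1, uniformly in [T]. *)
Lemma nat_time (R : realType) (T t : R) : 0 < T -> T < 1 -> 0 <= t ->
  exists i : nat, t <= i%:R * T <= t + 1.
Proof.
move=> T0 T1 t0; exists (Num.truncn (t / T)).+1.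
have [l u] := andP (truncn_itv (divr_ge0 t0 (ltW T0))).
move: l u; rewrite ler_pdivlMr// ltr_pdivrMr// => l u.
by rewrite (ltW u) -natr1 mulrDl mul1r lerD// ltW.
Qed.

Lemma cascade_near_KL_bound (R : realType) (F : set_system R) (FF : Filter F)
    (nx nz : nat) (f : R -> nat -> 'cV[R]_nx -> 'cV[R]_nz -> 'cV[R]_nx)
    (g : dt_family R nz) (gamma1 gamma2 gamma3 alpha1 alpha2 alpha3 L : R -> R)
    (betaz : R -> R -> R) (kappa : R -> R) (c : R) :
  class_K gamma1 -> class_N gamma2 -> class_K gamma3 ->
  class_K alpha1 -> class_K alpha2 -> class_K alpha3 -> class_N L ->
  (\forall T \near F, 0 < T < 1) ->
  (\forall T \near F, forall k x z,
     enorm (f T k x z) <= gamma1 (enorm (col_mx x z))) ->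
  (\forall T \near F, forall k x z,
     enorm (f T k x z - f T k x 0) <=
       T * gamma2 (enorm x) * gamma3 (enorm z)) ->
  (forall Delta nu, 0 < Delta -> 0 < nu -> \forall T \near F,
     exists V : nat -> 'cV[R]_nx -> R,
     [/\ forall k y, enorm y <= Delta ->
           alpha1 (enorm y) <= V k y <= alpha2 (enorm y),
         forall k y, enorm y <= Delta ->
           V k.+1 (f T k y 0) - V k y <= - (T * (alpha3 (enorm y) - nu))
       & forall k r s, Num.max (enorm r) (enorm s) <= Delta ->
           `|V k r - V k s| <=
             L (Num.max (enorm r) (enorm s)) * enorm (r - s)]) ->
  class_KL betaz -> near_KL_bound F g betaz ->
  class_K kappa ->
  (forall Delta, 0 < Delta -> \forall T \near F, forall k0 y0 j,
     enorm y0 <= Delta ->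
     enorm (iter_from (cascade f g T) k0 y0 j) <= kappa (enorm y0) + c) ->
  exists2 beta, class_KL beta & near_KL_bound F (cascade f g) beta.
Proof.
move=> g1K g2N g3K a1K a2K a3K LN FT Fgrowth Fcoupl FV bzKL Fz kK Fbnd.
have decay := cascade_decay FF g g1K g2N g3K a1K a2K a3K LN FT Fgrowth Fcoupl FV.
have dsub n m (y : 'cV[R]_(n + m)) : enorm (dsubmx y) <= enorm y.
  by have [] := enorm_col_mx_ge (usubmx y) (dsubmx y); rewrite vsubmxK.
have bnd s : 0 < s -> \forall T \near F, forall k0 y0 j, enorm y0 <= s ->
    enorm (iter_from (cascade f g T) k0 y0 j) <= Num.max 1 (kappa s + c).
  move=> s0; apply: filterS (Fbnd s s0) => T H k0 y0 j ys.
  apply: le_trans (H _ _ _ ys) _; rewrite le_max lerD2r.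
  by rewrite (class_K_le kK (enorm_ge0 _) ys) orbT.
(* The maximum with 1 makes the radius positive even for negative [c]. *)
have M0 s : 0 < Num.max 1 (kappa s + c) by rewrite lt_max ltr01.
apply: near_KL_boundI => [|s s0|e e0|s e s0 e0].
- by apply: filterS FT => T /andP[].
- exists (Num.max 1 (kappa s + c)).
  by apply: filterS (bnd s s0) => T H k0 y0 j ys _; exact: H.
(* Stability: the radius is the one for initial states of norm at most 1, so that it is fixed before
   [s <= 1] is chosen. *)
- have [eta eta0 [d d0 Fdecay]] := decay _ e (M0 1) e0.
  have ae0 : 0 < alpha1 (e / 2) by apply: class_K_gt0 => //; lra.
  have [s [s0 s1 as_ bs]] : exists s, [/\ 0 < s, s <= 1,
      alpha2 s <= alpha1 (e / 2) & betaz s 0 <= eta].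
    suff : \forall s \near 0^'+, [/\ 0 < s, s <= 1,
      alpha2 s <= alpha1 (e / 2) & betaz s 0 <= eta] by move/filter_ex.
    near=> s; split.
    + by near: s; exact: nbhs_right_gt.
    + by near: s; exact: nbhs_right_le.
    + by apply: ltW; near: s; exact: class_K_near0.
    + apply: ltW; near: s.
      exact: (@class_K_near0 _ (betaz^~ 0) _ (bzKL.1 _ (lexx 0))).
  exists s => //.
  apply: filterS (filterI FT (filterI Fdecay
    (filterI (bnd 1 ltr01) (Fz s eta s0 eta0)))).
  move=> T [/andP[T0 T1] [Tdecay [Tbnd Tz]]] k0 y0 j ys _.
  have y1 := le_trans ys s1.
  apply: Tdecay => [i|i|]; first exact: Tbnd.
    rewrite dsubmx_iter_cascade.
    have zs := le_trans (dsub _ _ y0) ys.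
    apply: le_trans (Tz _ _ _ zs) _; rewrite ge_max lexx andbT.
    apply: le_trans bs; apply: class_KL_le; rewrite ?enorm_ge0//.
    by rewrite mulr_ge0// ltW.
  have a2y := class_K_le a2K (enorm_ge0 _) ys.
  have : 0 <= j%:R * T * d by rewrite !mulr_ge0// ltW.
  by lra.
have [eta eta0 [d d0 Fdecay]] := decay _ e (M0 s) e0.
have [tau tau0 btau] : exists2 t, 0 <= t & betaz s t <= eta.
  have [_ /cvgrPdist_lt/(_ _ eta0) bs] := bzKL.2 s s0.
  suff : \forall t \near +oo, 0 <= t /\ betaz s t <= eta.
    by move=> /filter_ex[t []]; exists t.
  near=> t; split; first by near: t; apply: nbhs_pinfty_ge; rewrite num_real.
  suff : `|0 - betaz s t| < eta by rewrite sub0r normrN => /ltr_normlW/ltW.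
  by near: t.
set M := Num.max 1 (kappa s + c) in Fdecay.
have a2M := class_K_ge0 a2K (ltW (M0 s)).
(* Attraction: wait [tau], rounded up, until [z] stays below [eta]; then restart from the state
   reached, where [alpha2] is at most [alpha2 M], and decay at rate [d]. *)
exists (tau + 1 + alpha2 M / d).
  by rewrite !addr_ge0// divr_ge0// ltW.
apply: filterS (filterI FT (filterI Fdecay
  (filterI (bnd s s0) (Fz s eta s0 eta0)))).
move=> T [/andP[T0 T1] [Tdecay [Tbnd Tz]]] k0 y0 j ys tj.
have [i /andP[ti iT]] := nat_time T0 T1 tau0.
have a2d : 0 <= alpha2 M / d by rewrite divr_ge0// ltW.
have ij : (i <= j)%N.
  by rewrite -(ler_nat R) -(ler_pM2r T0); lra.
rewrite -(subnKC ij) iter_fromD; apply: Tdecay => [l|l|].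
- by rewrite -iter_fromD; exact: Tbnd.
- rewrite -iter_fromD dsubmx_iter_cascade.
  have zs := le_trans (dsub _ _ y0) ys.
  apply: le_trans (Tz _ _ _ zs) _; rewrite ge_max lexx andbT.
  apply: le_trans btau; apply: class_KL_le; rewrite ?enorm_ge0//.
  apply: le_trans ti _; rewrite ler_pM2r// ler_nat leq_addr //.
have a2y : alpha2 (enorm (iter_from (cascade f g T) k0 y0 i)) <= alpha2 M.
  by apply: class_K_le (enorm_ge0 _) (Tbnd _ _ _ ys).
have : alpha2 M <= (j - i)%:R * T * d.
  by rewrite -ler_pdivrMr// natrB// mulrBl; lra.
have : 0 < alpha1 (e / 2) by apply: class_K_gt0 => //; lra.
by lra.
Unshelve. all: by end_near. Qed.

(** * Specialization to the semiglobal and the global filter *)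

Lemma near_at_right0P (R : realType) (Q : R -> Prop) :
  (\forall T \near 0^'+, Q T) <->
  exists2 T0 : R, 0 < T0 & forall T, 0 < T -> T < T0 -> Q T.
Proof.
split=> [[T0 /= T00 H]|[T0 T00 H]].
  exists T0 => // T T1 T2; apply: H => //=.
  by rewrite sub0r normrN gtr0_norm.
by near=> T; apply: H; near: T; [exact: nbhs_right_gt|exact: nbhs_right_lt].
Unshelve. all: by end_near. Qed.

Lemma SP_UAS_near (R : realType) (n : nat) (Phi : dt_family R n) :
  SP_UAS Phi <->
  exists2 beta, class_KL beta & near_KL_bound (0 : R)^'+ Phi beta.
Proof.
split=> -[beta betaKL H]; exists beta => // Delta nu D0 nu0.
  apply/near_at_right0P; have [T0 T00 HT] := H _ _ D0 nu0.
  exists T0 => // T T1 T2 k0 y0 j yD.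
  by have := HT k0 y0 T (k0 + j)%N yD T1 T2 (leq_addr _ _); rewrite /solution addKn.
have /near_at_right0P[T0 T00 HT] := H _ _ D0 nu0.
by exists T0 => // k0 y0 T k yD T1 T2 _; exact: HT.
Qed.

(** The range of [T] is the same for all [Delta] and [nu], so for a fixed trajectory [Delta] can be
    fitted to the initial state and [nu] sent to 0. *)
Lemma near_KL_bound_UGAS (R : realType) (n : nat) (Phi : dt_family R n)
    (T0 : R) (beta : R -> R -> R) : 0 < T0 -> class_KL beta ->
  near_KL_bound (globally [set T | 0 < T < T0]) Phi beta -> UGAS Phi.
Proof.
move=> T00 betaKL H; exists beta => //; exists T0 => // k0 y0 T k T1 T2 _.
have b0 : 0 <= beta (enorm y0) ((k - k0)%:R * T).
  apply: (class_K_ge0 (betaKL.1 _ _)); last exact: enorm_ge0.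
  by rewrite mulr_ge0// ltW.
apply/ler_addgt0Pr => e e0.
have D0 : 0 < enorm y0 + 1 by have := enorm_ge0 y0; lra.
have := H _ e D0 e0 T; rewrite /= T1 T2 => /(_ isT k0 y0 (k - k0)%N).
move=> /(_ ltac:(lra)) /le_trans; apply; rewrite ge_max; lra.
Qed.

Theorem theorem3 (R : realType) (nx nz : nat)
    (f : R -> nat -> 'cV[R]_nx -> 'cV[R]_nz -> 'cV[R]_nx)
    (g : R -> nat -> 'cV[R]_nz -> 'cV[R]_nz)
    (gamma1 gamma2 gamma3 : R -> R) (Tstar : R)
    (hgamma1 : class_Kinfty gamma1)
    (hgamma2 : class_N gamma2)
    (hgamma3 : class_Kinfty gamma3)
    (hTstar : 0 < Tstar)
    (hgrowth : forall (T : R) (k : nat) (x : 'cV[R]_nx) (z : 'cV[R]_nz),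
       0 < T -> T < Tstar ->
       enorm (f T k x z) <= gamma1 (enorm (col_mx x z)))
    (hcoupling : forall (T : R) (k : nat) (x : 'cV[R]_nx) (z : 'cV[R]_nz),
       0 < T -> T < Tstar ->
       enorm (f T k x z - f T k x 0) <=
         T * gamma2 (enorm x) * gamma3 (enorm z)) :
  (Lyapunov_SP_UAS (zero_input f) -> SP_UAS g -> USB (cascade f g) ->
     SP_UAS (cascade f g)) /\
  (Lyapunov_UGAS (zero_input f) -> UGAS g -> UGB (cascade f g) ->
     UGAS (cascade f g)).
Proof.
split.
  move=> [alpha1 [alpha2 [alpha3 [L [[[a1K _] [a2K _] a3K LN] HV]]]]].
  move=> /SP_UAS_near[betaz bzKL Fz] [kappa [c [[kK _] Hbnd]]].
  apply/SP_UAS_near; apply: (cascade_near_KL_bound _ hgamma1.1 hgamma2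
    hgamma3.1 a1K a2K a3K LN _ _ _ _ bzKL Fz kK (c := c)).
  - by apply/near_at_right0P; exists 1 => // T T1 T2; apply/andP.
  - by apply/near_at_right0P; exists Tstar => // T T1 T2 k x z; exact: hgrowth.
  - by apply/near_at_right0P; exists Tstar => // T T1 T2 k x z; exact: hcoupling.
  - move=> Delta nu D0 nu0; apply/near_at_right0P.
    have [T0 T00 [V VT]] := HV _ _ D0 nu0; exists T0 => // T T1 T2.
    have [_ V1 V2 V3] := VT T T1 T2.
    by exists (fun k => V T k%:R); split.
  - move=> Delta D0; apply/near_at_right0P.
    have [T0 T00 HT] := Hbnd _ D0; exists T0 => // T T1 T2 k0 y0 j yD.
    have := HT k0 y0 T (k0 + j)%N yD T1 T2 (leq_addr _ _).
    by rewrite /solution addKn.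
move=> [alpha1 [alpha2 [alpha3 [L [[[a1K _] [a2K _] a3K LN]]]]]].
move=> [TV TV0 [V VT]] [betaz bzKL [Tz Tz0 Hz]].
move=> [kappa [c [[kK _] [Tb Tb0 Hb]]]].
(* The thresholds of all hypotheses, with 1 for the requirement [T < 1]. *)
pose T0 := Num.min (Num.min 1 Tstar) (Num.min TV (Num.min Tz Tb)).
have T00 : 0 < T0 by rewrite !lt_min ltr01 hTstar TV0 Tz0.
have FT (T : R) : [set T | 0 < T < T0] T ->
    0 < T /\ [/\ T < 1, T < Tstar, T < TV, T < Tz & T < Tb].
  by move=> /= /andP[-> ]; rewrite !lt_min => /andP[/andP[-> ->] /and3P[-> -> ->]].
suff [beta betaKL Fbeta] : exists2 beta, class_KL beta &
    near_KL_bound (globally [set T | 0 < T < T0]) (cascade f g) beta.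
  exact: near_KL_bound_UGAS betaKL Fbeta.
apply: (cascade_near_KL_bound _ hgamma1.1 hgamma2
  hgamma3.1 a1K a2K a3K LN _ _ _ _ bzKL _ kK (c := c)).
- by move=> T /FT[T1 [T2 _ _ _ _]]; apply/andP.
- by move=> T /FT[T1 [_ T2 _ _ _]] k x z; exact: hgrowth.
- by move=> T /FT[T1 [_ T2 _ _ _]] k x z; exact: hcoupling.
- move=> Delta nu D0 nu0 T /FT[T1 [_ _ T2 _ _]].
  have [_ V1 V2 V3] := VT T T1 T2.
  exists (fun k => V T k%:R); split=> // k y _.
  by apply: le_trans (V2 k y) _; rewrite lerN2 ler_pM2l//; lra.
- move=> Delta nu D0 nu0 T /FT[T1 [_ _ _ T2 _]] k0 y0 j _.
  have := Hz k0 y0 T (k0 + j)%N T1 T2 (leq_addr _ _).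
  by rewrite /solution addKn le_max => ->.
- move=> Delta D0 T /FT[T1 [_ _ _ _ T2]] k0 y0 j _.
  have := Hb k0 y0 T (k0 + j)%N T1 T2 (leq_addr _ _).
  by rewrite /solution addKn.
Qed.
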